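(* Let $p\in\{3,7\}$, let $f=f^{(p)}$ and let $f=\sum_{\upsilon=0}^{(p-1)/2}f_{\upsilon}$ be its orthogonal decomposition, as defined in the context. Then $$\frac{1}{2}[f_{0}^{+},f_{0}]+\sum_{\upsilon=1}^{(p-1)/2}[f_{\upsilon}^{+},f_{\upsilon}]=\mathrm{diag}\left(\frac{p}{2},\frac{p}{2}-1,\ldots,-\frac{p}{2}+1,-\frac{p}{2}\right),$$ and $$\sum_{\upsilon=0}^{(p-1)/2}[[f_{\upsilon}^{+},f_{\upsilon}],f_{\upsilon}]=-2f,\qquad \sum_{\upsilon=0}^{(p-1)/2}[[f_{\upsilon}^{+},f_{\upsilon}],f_{\upsilon}^{+}]=2f^{+}.$$
   Context: Here $X^{+}$ is the (conjugate) transpose of the real matrix $X$ and $[X,Y]=XY-YX$. Put $f^{(1)}=\begin{pmatrix}0&0\\1&0\end{pmatrix}$ and $c_{3}=\begin{pmatrix}0&1\\-1&0\end{pmatrix}$ (the paper's basis element $c_3$ of $Cl(2,1)$ is normalized so that $f^{(1)}=\frac12(c_2-c_3)$ with $c_2=\begin{pmatrix}0&1\\1&0\end{pmatrix}$). The matrices $f^{(3)}$ ($4\times4$) and $f^{(7)}$ ($8\times 8$) are given in $2\times2$ blocks by $$f^{(3)}=\begin{pmatrix}f^{(1)}&\mathbf{0}\\c_{3}&f^{(1)}\end{pmatrix},\qquad f^{(7)}=\begin{pmatrix}f^{(1)}&\mathbf{0}&\mathbf{0}&\mathbf{0}\\c_{3}&f^{(1)}&\mathbf{0}&\mathbf{0}\\c_{3}&c_{3}&f^{(1)}&\mathbf{0}\\c_{3}&c_{3}&c_{3}&f^{(1)}\end{pmatrix}.$$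 Orthogonal decomposition: for $\upsilon\in\{0,\dots,(p-1)/2\}$, $f_{\upsilon}$ is the matrix of the same size as $f$ whose $2\times 2$ block in block position $(\mu,s_{\upsilon}(\mu))$ equals the corresponding block of $f$, for every $\mu\in\{1,\dots,(p+1)/2\}$, all other blocks being zero. The index permutations $s_{\upsilon}$ are as follows (the two-digit symbol $\mu\nu$ meaning $s_{\upsilon}(\mu)=\nu$). For $p=3$: $s_0$: 11, 22; $s_1$: 12, 21. For $p=7$: $s_0$: 11, 22, 33, 44; $s_1$: 12, 21, 34, 43; $s_2$: 13, 24, 31, 42; $s_3$: 14, 23, 32, 41. *)

(* Defs.v *)
From HB Require Import structures.
From mathcomp Require Import all_boot all_order all_algebra.
From mathcomp Require Import reals.
Set Implicit Arguments.
Unset Strict Implicit.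
Unset Printing Implicit Defensive.
Import Order.TTheory GRing.Theory Num.Theory.
Local Open Scope ring_scope.

Definition mxcomm (R : pzRingType) (n : nat) (X Y : 'M[R]_n) : 'M[R]_n :=
  X *m Y - Y *m X.

Definition f1 (R : pzRingType) : 'M[R]_2 := delta_mx 1 0.

Definition c3 (R : pzRingType) : 'M[R]_2 := delta_mx 0 1 - delta_mx 1 0.

Definition nblocks (p : nat) : nat := p.+1./2.

(* The size p + 1 is presented as a sum of (p + 1) / 2 twos, the form for which
   [mxblock] and [submxblock] see a matrix made of 2 x 2 blocks; the sum
   evaluates to 4 for p = 3 and to 8 for p = 7. *)
Definition dimp (p : nat) : nat := \sum_(mu < nblocks p) 2.

(* f^(p): f^(1) on the block diagonal, c_3 in every block below it, and 0
   above it. *)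
Definition fmx (R : pzRingType) (p : nat) : 'M[R]_(dimp p) :=
  \mxblock_(mu < nblocks p, nu < nblocks p)
    (if nu == mu then f1 R else if (nu < mu)%N then c3 R else 0).

(* Row upsilon lists s_upsilon(0), s_upsilon(1), ...; block indices start at 0,
   so the two-digit symbol "23" is the value 2 in position 1. *)
Definition s_table (p : nat) : seq (seq nat) :=
  match p with
  | 3 => [:: [:: 0; 1];
             [:: 1; 0]]
  | 7 => [:: [:: 0; 1; 2; 3];
             [:: 1; 0; 3; 2];
             [:: 2; 3; 0; 1];
             [:: 3; 2; 1; 0]]
  | _ => [::]
  end%N.

Definition s_perm (p upsilon mu : nat) : nat :=
  nth 0%N (nth [::] (s_table p) upsilon) mu.

Definition fpart (R : pzRingType) (p upsilon : nat) : 'M[R]_(dimp p) :=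
  \mxblock_(mu < nblocks p, nu < nblocks p)
    (if nu == s_perm p upsilon mu :> nat then submxblock (fmx R p) mu nu else 0).

Definition spindiag (R : unitRingType) (p : nat) : 'M[R]_(dimp p) :=
  diag_mx (\row_(k < dimp p) (p%:R / 2 - k%:R)).

Lemma dimpE (p : nat) : odd p -> dimp p = p.+1.
Proof.
move=> p_odd; rewrite /dimp sum_nat_const card_ord /nblocks muln2.
by rewrite -[RHS]odd_double_half /= p_odd.
Qed.

Lemma fmx_decomposition (R : pzRingType) (p : nat) :
  p = 3 \/ p = 7 ->
  fmx R p = \sum_(0 <= upsilon < ((p - 1) %/ 2).+1) fpart R p upsilon.
Proof.
move=> hp; rewrite big_mkord; apply/mxblockP => mu nu.
rewrite submxblock_sum.
under eq_bigr do rewrite mxblockK.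
case: hp mu nu => -> mu nu; rewrite !big_ord_recl big_ord0 /s_perm /=.
  by case: mu => [[|[|[]]]] // ?; case: nu => [[|[|[]]]] // ? /=;
    rewrite !(add0r, addr0).
by case: mu => [[|[|[|[|[]]]]]] // ?; case: nu => [[|[|[|[|[]]]]]] // ? /=;
  rewrite !(add0r, addr0).
Qed.

(* Main.v *)
Require Import Defs.
From HB Require Import structures.
From mathcomp Require Import all_boot all_order all_algebra.
From mathcomp Require Import reals.
From mathcomp Require Import ring.
Set Implicit Arguments.
Unset Strict Implicit.
Unset Printing Implicit Defensive.
Import Order.TTheory GRing.Theory Num.Theory.
Local Open Scope ring_scope.

(** Each part [f_v] is a lowering matrix: [f_v *m f_v = 0] and
    [f_v *m f_v^T *m f_v = f_v].  These two relations alone force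
    [[f_v^T, f_v], f_v] = -2 f_v ([mxcomm_lowering]), and the relation for
    [f_v^T] is the transpose of that one; summing over [v] and using
    [f = \sum_v f_v] gives the last two identities.

    The two relations hold because [f_v] has at most one nonzero block per
    block row, placed by the involution [s_v], so products of such matrices are
    computed blockwise ([mulmx_permblock], [tr_permblock]).  The blocks [f1],
    [c3] and [0] are partial isometries; [f_v] squares to zero because [f1] does and because,
    for [v > 0], the involution [s_v] has no fixed point, so that one of the
    two positions [(mu, s_v mu)] and [(s_v mu, mu)] lies above the diagonal,
    where [f] vanishes.

    For the first identity, [[f_v^T, f_v]] is block diagonal.  For [v = 0] its
    blocks are [f1^T *m f1 - f1 *m f1^T = diag(1, -1)]; for [v > 0] its block
    [mu] is the identity if [mu < s_v mu] and minus the identity otherwise,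
    since [c3] is orthogonal.  With [n = (p + 1) / 2] blocks, [s_v mu] runs over
    all the indices other than [mu] when [v] runs over [1 .. n - 1], so these
    signs add up to [(n - 1 - mu) - mu] ([sum_block_sign]); adding [+-1/2]
    produces [p/2 - 2 mu] and [p/2 - (2 mu + 1)]. *)

(** * Commutators of a matrix with its transpose *)

(** Over the reals, the hypotheses say that [f] is a partial isometry whose
    initial and final spaces are orthogonal, so that [f^T *m f - f *m f^T] is
    [1] on the first and [-1] on the second. *)
Lemma mxcomm_lowering (R : comPzRingType) (n : nat) (f : 'M[R]_n) :
  f *m f = 0 -> f *m f^T *m f = f -> mxcomm (mxcomm f^T f) f = (- 2) *: f.
Proof.
move=> ff fff; rewrite /mxcomm mulmxBl mulmxBr fff mulmxA fff.
rewrite -mulmxA ff mulmx0 mulmxA ff mul0mx sub0r subr0.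
by rewrite scaleNr scaler_nat mulr2n opprD.
Qed.

Lemma tr_mxcomm (R : comPzRingType) (n : nat) (X Y : 'M[R]_n) :
  (mxcomm X Y)^T = mxcomm Y^T X^T.
Proof. by rewrite /mxcomm linearB /= !trmx_mul. Qed.

Lemma mxcommC (R : pzRingType) (n : nat) (X Y : 'M[R]_n) :
  mxcomm X Y = - mxcomm Y X.
Proof. by rewrite /mxcomm opprB. Qed.

Lemma mxcomm_raising (R : comPzRingType) (n : nat) (f : 'M[R]_n) :
  f *m f = 0 -> f *m f^T *m f = f -> mxcomm (mxcomm f^T f) f^T = 2 *: f^T.
Proof.
move=> ff fff; have /(congr1 trmx) := mxcomm_lowering ff fff.
rewrite !tr_mxcomm trmxK linearZ /= mxcommC scaleNr => /oppr_inj.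
exact.
Qed.

(** * Matrices with one block per block row *)

Section PermBlock.
Variables (n m : nat).
Implicit Types t u : 'I_n -> 'I_n.

Definition permblock (R : pzRingType) t (B : 'I_n -> 'M[R]_m) :
    'M[R]_(\sum_(mu < n) m) :=
  \mxblock_(mu < n, nu < n) (if nu == t mu then B mu else 0).

Lemma eq_permblock (R : pzRingType) t u (A B : 'I_n -> 'M[R]_m) :
  t =1 u -> A =1 B -> permblock t A = permblock u B.
Proof. by move=> tu AB; apply: eq_mxblock => mu nu; rewrite tu AB. Qed.

Lemma permblock0 (R : pzRingType) t : permblock t (fun=> 0 : 'M[R]_m) = 0.
Proof. by rewrite -mxblock0; apply: eq_mxblock => mu nu; rewrite if_same. Qed.

Lemma permblockB (R : pzRingType) t (A B : 'I_n -> 'M[R]_m) :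
  permblock t (fun mu => A mu - B mu) = permblock t A - permblock t B.
Proof.
by rewrite -mxblockB; apply: eq_mxblock => mu nu; case: eqP; rewrite ?subr0.
Qed.

Lemma permblockD (R : pzRingType) t (A B : 'I_n -> 'M[R]_m) :
  permblock t (fun mu => A mu + B mu) = permblock t A + permblock t B.
Proof.
by rewrite -mxblockD; apply: eq_mxblock => mu nu; case: eqP; rewrite ?addr0.
Qed.

Lemma permblock_sum (R : pzRingType) t (s : seq nat)
    (B : nat -> 'I_n -> 'M[R]_m) :
  permblock t (fun mu => \sum_(v <- s) B v mu)
  = \sum_(v <- s) permblock t (B v).
Proof.
elim: s => [|v s IHs].
  rewrite big_nil -[RHS](permblock0 _ t).
  by apply: eq_permblock => // mu; rewrite big_nil.
rewrite big_cons -IHs -permblockD.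
by apply: eq_permblock => // mu; rewrite big_cons.
Qed.

Lemma permblockZ (R : pzRingType) t (a : R) (B : 'I_n -> 'M[R]_m) :
  permblock t (fun mu => a *: B mu) = a *: permblock t B.
Proof.
by apply/matrixP => i j; rewrite !mxE; case: eqP; rewrite ?mxE ?mulr0.
Qed.

Lemma mulmx_permblock (R : pzRingType) t u (A B : 'I_n -> 'M[R]_m) :
  permblock t A *m permblock u B
  = permblock (u \o t) (fun mu => A mu *m B (t mu)).
Proof.
rewrite mul_mxblock; apply: eq_mxblock => mu nu.
rewrite (bigD1 (t mu)) //= eqxx big1 => [|k /negPf ->]; last by rewrite mul0mx.
by rewrite addr0; case: eqP; rewrite ?mulmx0.
Qed.

Lemma tr_permblock (R : pzRingType) t (B : 'I_n -> 'M[R]_m) :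
  involutive t -> (permblock t B)^T = permblock t (fun mu => (B (t mu))^T).
Proof.
move=> tK; rewrite tr_mxblock; apply: eq_mxblock => mu nu.
rewrite -(inj_eq (inv_inj tK)) tK eq_sym.
by case: eqP => [->|]; rewrite ?trmx0.
Qed.

(** Block diagonal, because the blocks of both products are placed by
    [t \o t], which is the identity. *)
Lemma mxcomm_permblock (R : comPzRingType) t (B : 'I_n -> 'M[R]_m) :
  involutive t ->
  mxcomm (permblock t B)^T (permblock t B)
  = permblock id (fun mu => (B (t mu))^T *m B (t mu) - B mu *m (B mu)^T).
Proof.
move=> tK; rewrite /mxcomm tr_permblock // !mulmx_permblock permblockB.
by congr (_ - _); apply: eq_permblock => mu //=; rewrite tK.
Qed.

Lemma diag_mx_permblock (R : pzRingType) (d : 'rV[R]_(\sum_(mu < n) m)) :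
  diag_mx d = permblock id (fun mu => diag_mx (submxrow d mu)).
Proof.
rewrite -[d in LHS]submxrowK diag_mxrow; apply: eq_mxblock => mu nu.
by rewrite eq_sym conform_mx_id.
Qed.

End PermBlock.

(** * The index permutations *)

(** [s_perm p v] as a map on block indices.  The default value [mu] of [insubd]
    makes it total; it is not taken for [p = 3] or [p = 7] and [v < nblocks p]
    ([s_permE]). *)
Definition s_ord (p v : nat) (mu : 'I_(nblocks p)) : 'I_(nblocks p) :=
  insubd mu (s_perm p v mu).

Section Parts.
Variable p : nat.
Hypothesis hp : p = 3%N \/ p = 7%N.

Lemma s_permE v (mu : 'I_(nblocks p)) :
  (v < nblocks p)%N -> s_perm p v mu = s_ord v mu.
Proof.
move=> lt_v; rewrite val_insubd; case: ltnP => //.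
case: hp mu lt_v => -> [mu lt_mu] /=.
  by case: v mu lt_mu => [|[|v]] // [|[|mu]].
by case: v mu lt_mu => [|[|[|[|v]]]] // [|[|[|[|mu]]]].
Qed.

Lemma s_ordK v : (v < nblocks p)%N -> involutive (@s_ord p v).
Proof.
move=> lt_v mu; apply/val_inj; rewrite /= -s_permE // -s_permE //.
case: hp mu lt_v => -> [mu lt_mu] /=.
  by case: v mu lt_mu => [|[|v]] // [|[|mu]].
by case: v mu lt_mu => [|[|[|[|v]]]] // [|[|[|[|mu]]]].
Qed.

Lemma s_ord0 (mu : 'I_(nblocks p)) : s_ord 0 mu = mu.
Proof.
apply/val_inj; rewrite /= -s_permE //; last by case: hp => ->.
case: hp mu => -> [mu lt_mu] /=; first by case: mu lt_mu => [|[|mu]].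
by case: mu lt_mu => [|[|[|[|mu]]]].
Qed.

Lemma s_ord_neq v (mu : 'I_(nblocks p)) :
  (0 < v < nblocks p)%N -> s_ord v mu != mu.
Proof.
case/andP=> v_gt0 lt_v; rewrite -val_eqE /= -s_permE //.
case: hp mu lt_v => -> [mu lt_mu] /=.
  by case: v v_gt0 mu lt_mu => [|[|v]] // _ [|[|mu]].
by case: v v_gt0 mu lt_mu => [|[|[|[|v]]]] // _ [|[|[|[|mu]]]].
Qed.

(** For fixed [mu], the [n - 1 - mu] indices above [mu] and the [mu] indices
    below it are each reached by [s_v mu] for exactly one [v > 0]. *)
Lemma sum_block_sign (R : comPzRingType) (mu : 'I_(nblocks p)) :
  \sum_(1 <= v < nblocks p) (if (mu < s_ord v mu)%N then 1 else -1)
  = (nblocks p).-1%:R - (2 * mu)%:R :> R.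
Proof.
transitivity (\sum_(1 <= v < nblocks p)
                (if (mu < s_perm p v mu)%N then 1 else -1 : R)).
  by apply: eq_big_nat => v /andP[_ lt_v]; rewrite s_permE.
case: hp mu => -> [mu lt_mu] /=.
  by case: mu lt_mu => [|[|mu]] // _; rewrite unlock /=; ring.
by case: mu lt_mu => [|[|[|[|mu]]]] // _; rewrite unlock /=; ring.
Qed.

(** * The parts of f *)

Section Blocks.
Variable R : comPzRingType.

Lemma f1_sqr0 : f1 R *m f1 R = 0.
Proof. by rewrite /f1 mul_delta_mx_cond. Qed.

Lemma mul_tr_f1 : (f1 R)^T *m f1 R = delta_mx 0 0.
Proof. by rewrite /f1 trmx_delta mul_delta_mx. Qed.

Lemma mul_f1_tr : f1 R *m (f1 R)^T = delta_mx 1 1.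
Proof. by rewrite /f1 trmx_delta mul_delta_mx. Qed.

Lemma mul_tr_c3 : (c3 R)^T *m c3 R = 1%:M.
Proof.
apply/matrixP => i j; rewrite !mxE !big_ord_recl big_ord0 !mxE.
case: i => [[|[|i]] hi] //; case: j => [[|[|j]] hj] //=; ring.
Qed.

Lemma mul_c3_tr : c3 R *m (c3 R)^T = 1%:M.
Proof.
apply/matrixP => i j; rewrite !mxE !big_ord_recl big_ord0 !mxE.
case: i => [[|[|i]] hi] //; case: j => [[|[|j]] hj] //=; ring.
Qed.

Definition part_block (v : nat) (mu : 'I_(nblocks p)) : 'M[R]_2 :=
  if v == 0%N then f1 R else if (s_ord v mu < mu)%N then c3 R else 0.

Lemma fpartE v : (v < nblocks p)%N ->
  fpart R p v = permblock (@s_ord p v) (part_block v).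
Proof.
move=> lt_v; apply: eq_mxblock => mu nu; rewrite s_permE // val_eqE.
case: eqP => // ->; rewrite mxblockK /part_block.
by case: v lt_v => [|v] lt_v /=; rewrite ?s_ord0 ?eqxx //
  (negPf (s_ord_neq _ _)).
Qed.

Lemma part_block_isometry v mu :
  part_block v mu *m (part_block v mu)^T *m part_block v mu = part_block v mu.
Proof.
rewrite /part_block; case: eqP => _.
  by rewrite mul_f1_tr /f1 mul_delta_mx.
by case: ifP; rewrite ?mul_c3_tr ?mul1mx ?mulmx0.
Qed.

(** For [v > 0] one of [mu] and [s_v mu] is the smaller, and the block in that
    row is zero; for [v = 0] both factors are [f1]. *)
Lemma part_block_nil v mu : (v < nblocks p)%N ->
  part_block v mu *m part_block v (s_ord v mu) = 0.
Proof.
move=> lt_v; rewrite /part_block s_ordK //; case: eqP => _.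
  exact: f1_sqr0.
by case: ltngtP; rewrite ?mul0mx ?mulmx0.
Qed.

Lemma fpart_sqr0 v : (v < nblocks p)%N -> fpart R p v *m fpart R p v = 0.
Proof.
move=> lt_v; rewrite fpartE // mulmx_permblock.
rewrite -(permblock0 _ _ (@s_ord p v \o @s_ord p v)).
by apply: eq_permblock => // mu; rewrite part_block_nil.
Qed.

Lemma fpart_isometry v : (v < nblocks p)%N ->
  fpart R p v *m (fpart R p v)^T *m fpart R p v = fpart R p v.
Proof.
move=> lt_v; have sK := s_ordK lt_v.
rewrite fpartE // tr_permblock // !mulmx_permblock.
by apply: eq_permblock => mu /=; rewrite !sK // part_block_isometry.
Qed.

Lemma mxcomm_fpart0 :
  mxcomm (fpart R p 0)^T (fpart R p 0)
  = permblock id (fun=> delta_mx 0 0 - delta_mx 1 1).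
Proof.
have lt0 : (0 < nblocks p)%N by case: hp => ->.
rewrite fpartE // mxcomm_permblock; last exact: s_ordK.
by apply: eq_permblock => // mu; rewrite mul_tr_f1 mul_f1_tr.
Qed.

Lemma mxcomm_fpart v : (0 < v < nblocks p)%N ->
  mxcomm (fpart R p v)^T (fpart R p v)
  = permblock id (fun mu => (if (mu < s_ord v mu)%N then 1 else -1)%:M).
Proof.
move=> v_int; have /andP[v_gt0 lt_v] := v_int.
have sK := s_ordK lt_v; rewrite fpartE // mxcomm_permblock //.
apply: eq_permblock => // mu; rewrite /part_block sK gtn_eqF //.
case: ltngtP => [_|_|/val_inj eq_mu].
- by rewrite mul_tr_c3 mul0mx subr0.
- by rewrite mul_c3_tr mulmx0 sub0r raddfN.
by have := s_ord_neq mu v_int; rewrite -eq_mu eqxx.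
Qed.

End Blocks.

(** * The spin matrix *)

(** Block [mu] holds the diagonal entries of index [2 mu] and [2 mu + 1], namely
    [p/2 - 1/2 - 2 mu] plus or minus [1/2], and [p/2 - 1/2 = n - 1]. *)
Lemma spindiagE (R : numFieldType) :
  spindiag R p
  = permblock id (fun mu : 'I_(nblocks p) =>
      2^-1 *: (delta_mx 0 0 - delta_mx 1 1)
      + ((nblocks p).-1%:R - (2 * mu)%:R)%:M).
Proof.
rewrite /spindiag diag_mx_permblock; apply: eq_permblock => // mu.
have pE : p%:R = 1 + 2 * (nblocks p).-1%:R :> R.
  by case: hp => ->; rewrite -natrM -[1]/(1%:R) -natrD.
apply/matrixP => i j; rewrite !mxE tagnat.RankEsum.
(* The blocks before block [mu] occupy the first [2 mu] indices. *)
rewrite -(big_ord_widen _ (fun=> 2%N)) 1?ltnW //.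
rewrite sum_nat_const card_ord pE natrD !natrM.
by case: i => [[|[|i]] lt_i] //; case: j => [[|[|j]] lt_j] //=; field.
Qed.

End Parts.

(** * The three identities *)

Theorem mainTheorem2 (R : realType) (p : nat) (hp : p = 3%N \/ p = 7%N) :
  let N := ((p - 1) %/ 2)%N in
  let f := fmx R p in
  let f_ := fpart R p in
  [/\ 2^-1 *: mxcomm (f_ 0%N)^T (f_ 0%N)
        + \sum_(1 <= v < N.+1) mxcomm (f_ v)^T (f_ v)
      = spindiag R p,
      \sum_(0 <= v < N.+1) mxcomm (mxcomm (f_ v)^T (f_ v)) (f_ v)
      = (- 2) *: f
    & \sum_(0 <= v < N.+1) mxcomm (mxcomm (f_ v)^T (f_ v)) (f_ v)^T
      = 2 *: f^T].
Proof.
move=> N f f_.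
have nE : N.+1 = nblocks p by rewrite /N; case: hp => ->.
split.
- rewrite /f_ mxcomm_fpart0 // spindiagE // -permblockZ permblockD.
  congr (_ + _).
  rewrite nE; transitivity (\sum_(1 <= v < nblocks p) permblock id
      (fun mu => (if (mu < @s_ord p v mu)%N then 1 else -1)%:M : 'M[R]_2)).
    by apply: eq_big_nat => v lt_v; rewrite mxcomm_fpart.
  rewrite -permblock_sum; apply: eq_permblock => // mu.
  by rewrite -raddf_sum sum_block_sign.
- rewrite /f fmx_decomposition // scaler_sumr; apply: eq_big_nat => v /= lt_v.
  by apply: mxcomm_lowering; [apply: fpart_sqr0 | apply: fpart_isometry];
    rewrite // -nE.
- rewrite /f fmx_decomposition // linear_sum scaler_sumr /=.
  apply: eq_big_nat => v /= lt_v.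
  by apply: mxcomm_raising; [apply: fpart_sqr0 | apply: fpart_isometry];
    rewrite // -nE.
Qed.
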